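(* Let $n$ be a positive integer and let $C$ be a strongly cancellative set on the Boolean lattice $B_n$. Then $|C|\le 2^{\lfloor n/2\rfloor}$.
   Context: The Boolean lattice $B_n$ is the lattice of all subsets of $\{1,\ldots,n\}$ ordered by inclusion, so that $a\wedge b = a\cap b$ and $a\vee b = a\cup b$. A strongly cancellative set of (or on) a lattice $L$ is a subset $C$ of the points of $L$ such that for any three different points $a_1,a_2,a_3\in C$, $a_1\wedge a_2\neq a_1\wedge a_3$ and $a_1\vee a_2\neq a_1\vee a_3$.
   Formalization: The formal theorem assumes n ≥ 2 instead of n positive: for n = 1 the claim fails, since C = B_1 has two points, is vacuously strongly cancellative, and 2 > 2^⌊1/2⌋ = 1. *)

(* Defs.v *)
From mathcomp Require Import all_boot all_order.

Set Implicit Arguments.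
Unset Strict Implicit.
Unset Printing Implicit Defensive.

(* makes {set T} a lattice: order \subset, meet :&:, join :|: *)
Export Order.DefaultSetSubsetOrder.

Definition strongly_cancellative (d : Order.disp_t) (L : latticeType d)
    (C : {pred L}) : Prop :=
  forall a1 a2 a3 : L, a1 \in C -> a2 \in C -> a3 \in C ->
    a1 <> a2 -> a1 <> a3 -> a2 <> a3 ->
    Order.meet a1 a2 <> Order.meet a1 a3 /\
    Order.join a1 a2 <> Order.join a1 a3.

(* A set with at most two points is vacuously strongly cancellative, so on
   B_1 the whole lattice is one, with 2 > 2 ^ (1 %/ 2) points. *)
Fact strongly_cancellative_B1 :
  strongly_cancellative [set: {set 'I_1}] /\
  #|[set: {set 'I_1}]| = 2.
Proof.
have card2 : #|[set: {set 'I_1}]| = 2.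
  by rewrite -powersetT card_powerset cardsT card_ord.
split=> // a b c _ _ _ /eqP nab /eqP nac /eqP nbc.
suff: #|[set a; b; c]| <= 2.
  by rewrite setUC !cardsU1 cards1 !inE !(eq_sym c)
             (negbTE nac) (negbTE nbc) nab.
by rewrite -card2; apply/subset_leq_card/subsetT.
Qed.

(* Main.v *)
Require Import Defs.
From mathcomp Require Import all_boot all_order.
From mathcomp Require Import zify.

(** If [C] is strongly cancellative and [a] is in [C], the traces [a :&: b] of
    the other points [b] of [C] are distinct subsets of [a], so [#|C|] is at
    most [2 ^ #|a| + 1]; complementing every point preserves strong
    cancellativity, so [#|C|] is also at most [2 ^ (n - #|a|) + 1].  Writing
    [k] for the integer part of [n / 2], one of these two exponents is at most
    [k], and it remains to exclude [#|C| = 2 ^ k + 1].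

    In that case every point has between [k] and [n - k] elements, and the
    traces on a point [a] of size [k] are all the subsets of [a]: one of them
    is [a] itself, so [a] lies strictly below another point of [C]
    ([strongly_cancellative_exists_above]).  For [n] even this is absurd,
    since all the points have the same size [k].  For [n] odd, it sends each
    point of size [k] to a point of size [k + 1], injectively, since two points
    below a third have the same join with it ([card_level_leq]).  By
    complementation there are as many points of either size, so [#|C|] is even,
    whereas [2 ^ k + 1] is odd because [k > 0]. *)

Section StronglyCancellative.
Variable T : finType.
Implicit Types (C : {set {set T}}) (a b : {set T}).

Lemma strongly_cancellative_setI C a b1 b2 : strongly_cancellative C ->
  a \in C -> b1 \in C :\ a -> b2 \in C :\ a -> a :&: b1 = a :&: b2 -> b1 = b2.
Proof.
move=> hC aC /setD1P[b1a b1C] /setD1P[b2a b2C] eqI.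
case: (eqVneq b1 b2) => // b12.
move: b1a b2a b12 => /eqP b1a /eqP b2a /eqP b12.
by have [/(_ eqI)] := hC a b1 b2 aC b1C b2C (nesym b1a) (nesym b2a) b12.
Qed.

Lemma strongly_cancellative_setU C a b1 b2 : strongly_cancellative C ->
  a \in C -> b1 \in C :\ a -> b2 \in C :\ a -> a :|: b1 = a :|: b2 -> b1 = b2.
Proof.
move=> hC aC /setD1P[b1a b1C] /setD1P[b2a b2C] eqU.
case: (eqVneq b1 b2) => // b12.
move: b1a b2a b12 => /eqP b1a /eqP b2a /eqP b12.
by have [_ /(_ eqU)] := hC a b1 b2 aC b1C b2C (nesym b1a) (nesym b2a) b12.
Qed.

(** Complementation exchanges meets and joins, so it turns each statement
    about lower sets into one about upper sets. *)
Lemma strongly_cancellative_setC C : strongly_cancellative C ->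
  strongly_cancellative [set ~: a | a in C].
Proof.
move=> hC _ _ _ /imsetP[a aC ->] /imsetP[b bC ->] /imsetP[c cC ->] ab ac bc.
have [|||nmeet njoin] := hC a b c aC bC cC; try by move=> e; rewrite e in ab ac bc.
split=> [/= e|/= e].
- apply: njoin; apply: setC_inj; rewrite /= !Order.SetSubsetOrder.joinEsubset !setCU.
  by move: e; rewrite !Order.SetSubsetOrder.meetEsubset.
- apply: nmeet; apply: setC_inj; rewrite /= !Order.SetSubsetOrder.meetEsubset !setCI.
  by move: e; rewrite !Order.SetSubsetOrder.joinEsubset.
Qed.

Lemma traces_sub C a : [set a :&: b | b in C :\ a] \subset powerset a.
Proof. by apply/subsetP=> _ /imsetP[b _ ->]; rewrite powersetE subsetIl. Qed.

Lemma card_traces C a : strongly_cancellative C -> a \in C ->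
  #|[set a :&: b | b in C :\ a]|.+1 = #|C|.
Proof.
move=> hC aC; rewrite card_in_imset; first by rewrite (cardsD1 a C) aC.
by move=> b1 b2; apply: strongly_cancellative_setI.
Qed.

Lemma strongly_cancellative_card C a : strongly_cancellative C -> a \in C ->
  #|C| <= (2 ^ #|a|).+1.
Proof.
move=> hC aC; rewrite -(card_traces _ a hC aC) ltnS -card_powerset.
exact/subset_leq_card/traces_sub.
Qed.

Lemma strongly_cancellative_size_ge C a k : strongly_cancellative C ->
  a \in C -> 2 ^ k < #|C| -> k <= #|a|.
Proof.
move=> hC aC large.
have := leq_trans large (strongly_cancellative_card _ a hC aC).
by rewrite ltnS leq_exp2l.
Qed.

Lemma strongly_cancellative_size_le C a k : strongly_cancellative C ->
  a \in C -> 2 ^ k < #|C| -> #|a| + k <= #|T|.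
Proof.
move=> hC aC large; rewrite -(cardsC a) leq_add2l.
apply: (strongly_cancellative_size_ge _ _ _ (strongly_cancellative_setC _ hC)).
  exact: imset_f.
by rewrite (card_imset _ (@setC_inj T)).
Qed.

(** When the bound of [strongly_cancellative_card] is attained, every subset
    of [a] is a trace, and the trace [a] comes from a point above [a]. *)
Lemma strongly_cancellative_exists_above C a : strongly_cancellative C ->
  a \in C -> 2 ^ #|a| < #|C| -> exists2 b, b \in C & a \proper b.
Proof.
move=> hC aC large.
have /eqP traces : [set a :&: b | b in C :\ a] == powerset a.
  by rewrite eqEcard traces_sub card_powerset -ltnS card_traces.
have: a \in powerset a by rewrite powersetE.
rewrite -traces => /imsetP[b /setD1P[ba bC] eq_a].
by exists b => //; rewrite properEneq eq_sym ba; apply/setIidPl.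
Qed.

Definition level C k : {set {set T}} := [set a in C | #|a| == k].

(** The hypothesis on [#|C|] makes the bound of [strongly_cancellative_card]
    tight at every point of size [k], so each has a point above it, which can
    only have size [k.+1]; this choice is injective because two points below
    the same [b] both have join [b] with it. *)
Lemma card_level_leq C k : strongly_cancellative C -> 2 ^ k < #|C| ->
  (forall b, b \in C -> #|b| <= k.+1) -> #|level C k| <= #|level C k.+1|.
Proof.
move=> hC large size_le.
pose above a : {set T} := odflt a [pick b in C | a \proper b].
have aboveP a : a \in level C k -> above a \in C /\ a \proper above a.
  rewrite inE => /andP[aC /eqP sz_a]; rewrite /above.
  case: pickP => [b /andP[]//|none].
  have [|b bC ab] := strongly_cancellative_exists_above C a hC aC.
    by rewrite sz_a.
  by have := none b; rewrite bC ab.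
have above_inj : {in level C k &, injective above}.
  move=> a1 a2 a1k a2k eq_above.
  have [bC ab1] := aboveP _ a1k; have [_ ab2] := aboveP _ a2k.
  rewrite -eq_above in ab2.
  have other a : a \in level C k -> a \proper above a1 -> a \in C :\ above a1.
    by rewrite !inE properEneq => /andP[-> _] /andP[->].
  apply: (strongly_cancellative_setU _ (above a1) _ _ hC bC) => //;
    try exact: other.
  by rewrite (setUidPl (proper_sub ab1)) (setUidPl (proper_sub ab2)).
rewrite -(card_in_imset above_inj); apply/subset_leq_card/subsetP.
move=> _ /imsetP[a ak ->]; have [bC ab] := aboveP _ ak.
have := proper_card ab; move: ak; rewrite !inE bC => /andP[_ /eqP ->].
by rewrite eqn_leq size_le.
Qed.

Lemma card_level_setC C i j : i + j = #|T| ->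
  #|level [set ~: a | a in C] i| = #|level C j|.
Proof.
move=> ij; rewrite -(card_imset _ (@setC_inj T)); apply: eq_card => a.
apply/imsetP/idP => [[b]|].
  rewrite inE => /andP[/imsetP[c cC ->] /eqP sz ->].
  by rewrite setCK inE cC; have := cardsC c; lia.
rewrite inE => /andP[aC /eqP sz]; exists (~: a); last by rewrite setCK.
by rewrite inE imset_f //=; have := cardsC a; lia.
Qed.

Lemma strongly_cancellative_half_bound C : 1 < #|T| ->
  strongly_cancellative C -> #|C| <= 2 ^ (#|T| %/ 2).
Proof.
move=> T_gt1 hC; set k := #|T| %/ 2; rewrite leqNgt; apply/negP => large.
have size_ge a : a \in C -> k <= #|a|.
  by move=> aC; apply: strongly_cancellative_size_ge large.
have size_le a : a \in C -> #|a| + k <= #|T|.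
  by move=> aC; apply: strongly_cancellative_size_le large.
have size_leS a : a \in C -> #|a| <= k.+1 by move/size_le; lia.
have card_levels : #|C| = #|level C k| + #|level C k.+1|.
  rewrite -(cardsID [set a : {set T} | #|a| == k] C).
  congr (_ + _); apply: eq_card => a; rewrite !inE // andbC.
  by case aC: (a \in C) => //=; have := size_ge a aC; have := size_leS a aC; lia.
have le_up := card_level_leq C k hC large size_leS.
have [T_even|T_odd] : #|T| = k + k \/ #|T| = k + k.+1 by lia.
  have : level C k.+1 = set0.
    by apply/setP=> a; rewrite !inE; case aC: (a \in C) => //=;
       have := size_le a aC; lia.
  by move=> top0; move: large card_levels le_up; rewrite top0 cards0; lia.
have le_down : #|level C k.+1| <= #|level C k|.
  rewrite -(card_level_setC C k k.+1) // -(card_level_setC C k.+1 k); last by lia.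
  apply: card_level_leq; first exact: strongly_cancellative_setC.
    by rewrite (card_imset _ (@setC_inj T)).
  move=> _ /imsetP[a aC ->]; have := size_ge a aC; have := cardsC a; lia.
have same_card : #|level C k| = #|level C k.+1|.
  by apply/eqP; rewrite eqn_leq le_up.
have C_even : ~~ odd #|C| by rewrite card_levels same_card addnn odd_double.
have [a aC] : exists a, a \in C by apply/card_gt0P/(leq_trans _ large).
(* The upper bound comes from [a] itself or from its complement, whichever has
   size [k]. *)
have card_le : #|C| <= (2 ^ k).+1.
  have [/eqP sz|sz] := boolP (#|a| == k).
    by rewrite -sz; apply: strongly_cancellative_card.
  have sz' : #|~: a| = k.
    by have := size_ge a aC; have := size_le a aC; have := cardsC a; lia.
  rewrite -(card_imset _ (@setC_inj T)) -sz'.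
  by apply: strongly_cancellative_card; [apply: strongly_cancellative_setC|
    apply: imset_f].
have eqC : #|C| = (2 ^ k).+1 by apply/eqP; rewrite eqn_leq card_le.
by move: C_even; rewrite eqC /= oddX; lia.
Qed.

End StronglyCancellative.

Theorem theorem4p2 (n : nat) (hn : 1 < n) (C : {set {set 'I_n}})
  (hC : strongly_cancellative C) : #|C| <= 2 ^ (n %/ 2).
Proof.
rewrite -[X in X %/ 2](card_ord n).
by apply: strongly_cancellative_half_bound; rewrite ?card_ord.
Qed.
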